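(* For every prime power $q$ and integer $k\ge 2$, there is a strong blocking set in $\mathrm{PG}(k-1,q)$ of size at most \[(q+1)\frac{2k}{\log_q\left(\frac{q^4}{q^3-q+1}\right)}.\]
   Context: $\mathrm{PG}(k-1,q)$ is the projective space whose points, lines, ..., hyperplanes are the $1$-, $2$-, ..., $(k-1)$-dimensional vector subspaces of $\mathbb{F}_q^k$. A strong blocking set in $\mathrm{PG}(k-1,q)$ is a set $S$ of points such that for every hyperplane $H$, the points of $S\cap H$ span $H$. *)

(* Defs.v *)
From HB Require Import structures.
From mathcomp Require Import all_boot all_order all_algebra.
From mathcomp Require Import reals exp.
Set Implicit Arguments. Unset Strict Implicit. Unset Printing Implicit Defensive.
Import Order.TTheory GRing.Theory Num.Theory.
Local Open Scope ring_scope.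

(* Points of PG(k-1,q) = 1-dim subspaces of F^k, F a finite field with #|F| = q.
   A set of points is represented by a set of nonzero row vectors in 'rV[F]_k,
   one representative per point (no two proportional). *)
Definition PG_point_set (F : finFieldType) (k : nat) (S : {set 'rV[F]_k}) : Prop :=
  (forall v, v \in S -> v != 0) /\
  {in S &, forall u v, (u == v)%MS -> u = v}.

(* Hyperplanes of PG(k-1,q) = (k-1)-dim subspaces of F^k, given as the row
   space of a k x k matrix of rank k-1. *)
Definition is_hyperplane (F : finFieldType) (k : nat) (H : 'M[F]_k) : Prop :=
  \rank H = k.-1.

Definition strong_blocking_set (F : finFieldType) (k : nat) (S : {set 'rV[F]_k}) : Prop :=
  forall H : 'M[F]_k, is_hyperplane H ->
    (H == \sum_(v in S | (v <= H)%MS) <<v>>)%MS.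

(* Main.v *)
(* The points of a set T meet every hyperplane in a spanning set iff, for any
   two independent functionals u and v, some point of T is killed by u but not
   by v.  A pair (u, v) is a matrix W of full column rank, and its restriction
   to the line spanned by the rows of a uniform f : 'M_(2, k) is the uniform
   2 x 2 matrix f *m W; at most q^3 - q + 1 of the q^4 such matrices give no
   suitable point.  Hence t lines can be chosen greedily so that at most
   q^(2k) ((q^3 - q + 1) / q^4)^t pairs remain.  The remaining pairs come in
   classes of size q (q-1)^2, one for each hyperplane and codimension-2
   subspace in it, and a class is repaired by adding one point.  With t the
   integer part of x = 2k / log_q (q^4 / (q^3 - q + 1)), no pair remains when
   q > 2; when q = 2, at most one class remains, and none if the fractional
   part of x is below 1/3, so that the extra point fits in 3 x. *)
Require Import Defs.
From HB Require Import structures.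
From mathcomp Require Import all_boot all_order all_algebra.
From mathcomp Require Import reals exp.
From mathcomp Require Import zify ring lra.
Import Order.TTheory GRing.Theory Num.Theory.
Local Open Scope ring_scope.

(** * Elementary matrix facts *)

Lemma eqmx_row_eq0 (K : fieldType) n (v w : 'rV[K]_n) :
  (v == w)%MS -> v = 0 -> w = 0.
Proof. by move=> /eqmxP vw v0; apply/eqP; rewrite -submx0 -vw v0 sub0mx. Qed.

Lemma mul_col_entry (K : fieldType) m n p
  (A : 'M[K]_(m, n)) (B : 'M_(n, p)) i j :
  (A *m col j B) i 0 = (A *m B) i j.
Proof. by rewrite colE mulmxA -colE [LHS]mxE. Qed.

Lemma row2_sum_delta (K : fieldType) (x : 'rV[K]_2) :
  x = x 0 0 *: delta_mx 0 0 + x 0 1 *: delta_mx 0 1.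
Proof.
rewrite [LHS]row_sum_delta !big_ord_recl big_ord0 addr0.
by congr (_ + x 0 _ *: delta_mx _ _); apply: val_inj.
Qed.

(** * Pairs of functionals and the points of a line that cover them *)

Section Covering.
Variables (F : finFieldType) (k : nat).
Local Notation q := #|F|.
Local Notation e1 := (delta_mx 0 1 : 'rV[F]_2).
Implicit Types (T S : {set 'rV[F]_k}) (W : 'M[F]_(k, 2)) (f : 'M[F]_(2, k)).

(* With u and v the columns of W, [covers x W] says that x is killed by u
   but not by v. *)
Definition covers (x : 'rV[F]_k) W := (x *m W == e1)%MS.

Definition uncovered T : {set 'M[F]_(k, 2)} :=
  [set W | row_full W & [forall v in T, ~~ covers v W]].

Lemma uncoveredP T W :
  reflect (row_full W /\ forall v, v \in T -> ~~ covers v W) (W \in uncovered T).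
Proof.
rewrite inE; apply: (iffP andP) => -[Wf h]; split=> //; first exact/forall_inP.
exact/forall_inP.
Qed.

(** One representative for each of the q + 1 points of the projective line. *)
Definition proj_line : {set 'rV[F]_2} :=
  e1 |: [set delta_mx 0 0 + c *: e1 | c : F].

Lemma card_proj_line : (#|proj_line| <= q + 1)%N.
Proof.
rewrite addnC; apply: leq_trans (leq_card_setU _ _) _.
by rewrite cards1 leq_add2l; apply: leq_imset_card.
Qed.

Lemma proj_line_repr (x : 'rV[F]_2) :
  x != 0 -> exists s, exists2 y, s != 0 & y \in proj_line /\ x = s *: y.
Proof.
have xE := row2_sum_delta _ x.
move=> x0; have [x00|x00] := eqVneq (x 0 0) 0.
  exists (x 0 1), e1; last by rewrite setU11 {1}xE x00 scale0r add0r.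
  by apply: contra_neq x0 => x01; rewrite xE x00 x01 !scale0r addr0.
exists (x 0 0), (delta_mx 0 0 + (x 0 1 / x 0 0) *: e1) => //; split.
  by apply/setU1P; right; apply: imset_f.
by rewrite {1}xE scalerDr scalerA mulrC divfK.
Qed.

(** If [e1 = D *m (f *m W)], then [D *m f] covers [W], and replacing [D] by its representative in
    [proj_line] only rescales it. *)
Lemma sub_line_covers f W :
  (e1 <= f *m W)%MS ->
  exists2 v, v \in [set x *m f | x in proj_line] & covers v W.
Proof.
case/submxP=> D DE; have D0 : D != 0.
  apply: contraTneq (oner_neq0 F) => D0; move/matrixP: DE => /(_ 0 1).
  by rewrite D0 mul0mx !mxE !eqxx negbK => /eqP.
have [s [y s0 [yX yD]]] := proj_line_repr D D0.
exists (y *m f); first exact: imset_f.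
apply/eqmxP/eqmx_sym; rewrite DE yD -scalemxAl mulmxA.
exact: eqmx_scale.
Qed.

(** * Counting the matrices and lines that give no suitable point *)

Lemma card_missing_mx2 :
  (#|[set M : 'M[F]_2 | ~~ (e1 <= M)%MS]| <= q ^ 3 - q + 1)%N.
Proof.
pose nz := [set~ 0 : 'cV[F]_2].
pose g (ac : 'cV[F]_2 * F) := ac.1 *m (delta_mx 0 0 + ac.2 *: e1).
have cnz : (#|nz| = q ^ 2 - 1)%N by rewrite cardsC1 card_mx muln1 subn1.
have -> : (q ^ 3 - q + 1 = 1 + (q ^ 2 - 1) * q)%N.
  by rewrite mulnBl mul1n -expnSr addnC.
have bnd : (#|0%R |: [set g ac | ac in setX nz setT]| <= 1 + (q ^ 2 - 1) * q)%N.
  apply: leq_trans (leq_card_setU _ _) _; rewrite cards1 leq_add2l.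
  by apply: leq_trans (leq_imset_card _ _) _; rewrite cardsX cnz cardsT.
apply: leq_trans bnd; apply/subset_leq_card/subsetP => M.
rewrite inE => Me; apply/setU1P.
(* A row killing column 0 but not column 1 would put a multiple of [e1] in the row space. So column
   1 is a multiple of column 0: [M] is zero or one of (q^2 - 1) q products [g ac]. *)
have key (x : 'rV_2) : x *m col 0 M = 0 -> x *m col 1 M = 0.
  move=> x0; apply: contraNeq Me => x1.
  have x1' : (x *m col 1 M) 0 0 != 0.
    by apply: contra_neq x1 => x1; rewrite [LHS]mx11_scalar x1 raddf0.
  have -> : e1 = (((x *m col 1 M) 0 0)^-1 *: x) *m M; last exact: submxMl.
  rewrite -scalemxAl; apply/rowP => j.
  rewrite mxE [RHS]mxE -[(x *m M) 0 j]mul_col_entry.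
  case: j => [[|[|]]] //= h.
    by rewrite (_ : Ordinal h = 0) ?x0 ?mxE ?mulr0 //; apply: val_inj.
  by rewrite (_ : Ordinal h = 1) ?mulVf //; apply: val_inj.
have [a0|a0] := eqVneq (col 0 M) 0.
  left; have b0 : col 1 M = 0.
    by rewrite -[LHS]mul1mx; apply/row_matrixP => i;
      rewrite row_mul key ?row0 // a0 mulmx0.
  apply/matrixP => i j; rewrite mxE.
  case: j => [[|[|]]] //= h.
    by move/colP: a0 => /(_ i); rewrite !mxE => <-; congr (M i _);
      apply: val_inj.
  by move/colP: b0 => /(_ i); rewrite !mxE => <-; congr (M i _); apply: val_inj.
right; suff [c cE] : exists c, col 1 M = c *: col 0 M.
  apply/imsetP; exists (col 0 M, c); first by rewrite !inE a0.
  rewrite /g /= mulmxDr -scalemxAr; apply/matrixP => i j.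
  move/colP: cE => /(_ i); rewrite !mxE !big_ord1 !mxE.
  case: j => [[|[|]]] //= h.
    by move=> _; rewrite mulr0 mulr1 mulr0 addr0; congr (M i _); apply: val_inj.
  by rewrite mulr0 add0r mulr1 => <-; congr (M i _); apply: val_inj.
have /cV0Pn[i ai] := a0.
exists (M i 1 / M i 0); apply/colP => j.
(* This combination of unit rows is chosen to kill column 0. *)
have := key (delta_mx 0 j - (M j 0 / M i 0) *: delta_mx 0 i).
rewrite !mulmxBl -!scalemxAl -!rowE => kk.
have /colP/(_ 0) : row j (col 1 M) - M j 0 / M i 0 *: row i (col 1 M) = 0.
  by apply: kk; apply/colP => z; rewrite !mxE divfK ?subrr //; rewrite mxE in ai.
by rewrite !mxE => /eqP; rewrite subr_eq0 => /eqP ->; field; rewrite mxE in ai.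
Qed.

(* Translation by [M *m pinvmx W] identifies the fibres of [f |-> f *m W],
   so [f *m W] is equidistributed. *)
Lemma card_missing_line W : row_full W ->
  (#|[set f : 'M[F]_(2, k) | ~~ (e1 <= f *m W)%MS]| * q ^ 4
   <= (q ^ 3 - q + 1) * q ^ (2 * k))%N.
Proof.
move=> Wf; pose K := #|[set f : 'M[F]_(2, k) | f *m W == 0]|.
have fib M : #|[set f : 'M[F]_(2, k) | f *m W == M]| = K.
  rewrite /K -[RHS](card_imset _ (@addrI _ (M *m pinvmx W))).
  apply: eq_card => f; rewrite inE; apply/eqP/imsetP => [fW|[g]].
    exists (f - M *m pinvmx W); last by rewrite addrC subrK.
    by rewrite inE mulmxBl fW -mulmxA mulVpmx // mulmx1 subrr.
  rewrite inE => /eqP gW ->.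
  by rewrite mulmxDl gW -mulmxA mulVpmx // mulmx1 addr0.
have tot (B : {set 'M[F]_2}) : #|[set f : 'M[F]_(2, k) | f *m W \in B]| =
    (#|B| * K)%N.
  rewrite -sum1_card (partition_big (fun f => f *m W) [in B]) /=; last first.
    by move=> f; rewrite inE.
  rewrite -sum_nat_const; apply: eq_bigr => M MB.
  rewrite sum1_card -(fib M); apply: eq_card => f; rewrite !inE.
  by rewrite unfold_in /= inE; case: eqP => [->|//]; rewrite ?MB ?andbF.
(* The case of all matrices gives q^(2k) = q^4 K, which eliminates [K]. *)
have := tot [set M | ~~ (e1 <= M)%MS]; have := tot setT.
rewrite cardsT card_mx => totT.
have -> : (q ^ (2 * k) = q ^ (2 * 2) * K)%N.
  by rewrite -totT -card_mx -cardsT; apply: eq_card => f; rewrite !inE.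
have -> : #|[set f : 'M[F]_(2, k) | f *m W \in [set M | ~~ (e1 <= M)%MS]]| =
          #|[set f : 'M[F]_(2, k) | ~~ (e1 <= f *m W)%MS]|.
  by apply: eq_card => f; rewrite !inE.
move=> ->; rewrite -mulnA [(K * _)%N]mulnC leq_mul2r.
by rewrite card_missing_mx2 orbT.
Qed.

(** * Greedy choice of lines *)

Lemma good_line (P : {set 'M[F]_(k, 2)}) :
  {in P, forall W, row_full W} ->
  exists f, (#|[set W in P | ~~ (e1 <= f *m W)%MS]| * q ^ 4
             <= #|P| * (q ^ 3 - q + 1))%N.
Proof.
(* Averaging: if every [f] exceeded the bound, summing over [f] and exchanging the sums would
   contradict [card_missing_line]. *)
move=> Pf; apply/existsP; rewrite -[X in is_true X]negbK negb_exists.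
apply/negP => /forallP h.
have q0 : (0 < q)%N by apply/card_gt0P; exists 0.
have dc : (\sum_(f : 'M[F]_(2, k)) #|[set W in P | ~~ (e1 <= f *m W)%MS]| =
           \sum_(W in P) #|[set f : 'M[F]_(2, k) | ~~ (e1 <= f *m W)%MS]|)%N.
  transitivity (\sum_(f : 'M[F]_(2, k)) \sum_(W in P)
    (~~ (e1 <= f *m W)%MS : nat))%N.
    apply: eq_bigr => f _; rewrite -sum1_card big_mkcond [RHS]big_mkcond /=.
    by apply: eq_bigr => W _; rewrite inE;
      case: (W \in P) => //; case: (_ <= _)%MS.
  rewrite exchange_big; apply: eq_bigr => W _.
  rewrite -sum1_card [RHS]big_mkcond /=; apply: eq_bigr => f _.
  by rewrite inE; case: (_ <= _)%MS.
have up : ((\sum_(f : 'M[F]_(2, k)) #|[set W in P | ~~ (e1 <= f *m W)%MS]|)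
   * q ^ 4
   <= #|P| * ((q ^ 3 - q + 1) * q ^ (2 * k)))%N.
  rewrite dc big_distrl /= -sum_nat_const; apply: leq_sum => W WP.
  exact/card_missing_line/Pf.
have : (\sum_(f : 'M[F]_(2, k)) (#|P| * (q ^ 3 - q + 1)).+1 <=
  (\sum_(f : 'M[F]_(2, k)) #|[set W in P | ~~ (e1 <= f *m W)%MS]|) * q ^ 4)%N.
  by rewrite big_distrl /=; apply: leq_sum => f _; rewrite ltnNge; apply: h.
rewrite sum_nat_const card_mx => /leq_trans/(_ up).
rewrite mulnA [leqRHS]mulnC leq_pmul2l ?expn_gt0 ?q0 //.
by rewrite ltnn.
Qed.

Lemma greedy_lines t : exists T,
  (#|T| <= (q + 1) * t)%N /\
  (#|uncovered T| * q ^ (4 * t) <= q ^ (2 * k) * (q ^ 3 - q + 1) ^ t)%N.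
Proof.
elim: t => [|t [T [Tt Tu]]].
  exists set0; rewrite cards0; split=> //.
  by rewrite muln0 !expn0 !muln1 (mulnC 2%N) -card_mx max_card.
have [W|f fP] := good_line (uncovered T); first by case/uncoveredP.
exists (T :|: [set x *m f | x in proj_line]); split.
  apply: leq_trans (leq_card_setU _ _) _; rewrite mulnS addnC leq_add //.
  exact: leq_trans (leq_imset_card _ _) card_proj_line.
have sub : uncovered (T :|: [set x *m f | x in proj_line]) \subset
           [set W in uncovered T | ~~ (e1 <= f *m W)%MS].
  apply/subsetP => W /uncoveredP[Wf h]; rewrite inE; apply/andP; split.
    by apply/uncoveredP; split=> // v vT; apply: h; rewrite inE vT.
  apply/negP => /sub_line_covers[v vX]; apply/negP/h.
  by rewrite inE vX orbT.
have {}sub := subset_leq_card sub.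
rewrite mulnS expnD mulnA.
apply: leq_trans (leq_mul (leq_mul sub (leqnn _)) (leqnn _)) _.
apply: leq_trans (leq_mul fP (leqnn _)) _.
by rewrite (expnSr _ t) mulnAC mulnA leq_mul.
Qed.

(** * Repairing the remaining classes of pairs *)

Definition upper_mx (abc : F * F * F) : 'M[F]_2 :=
  abc.1.1 *: delta_mx 0 0 + abc.1.2 *: delta_mx 1 1 + abc.2 *: delta_mx 0 1.

Lemma mul_e1_upper abc : e1 *m upper_mx abc = abc.1.2 *: e1.
Proof.
rewrite !mulmxDr -!scalemxAr !mul_delta_mx_cond /=.
by rewrite !mulr0n mulr1n !scaler0 add0r addr0.
Qed.

Lemma upper_mxV abc : abc.1.1 != 0 -> abc.1.2 != 0 ->
  upper_mx abc *m
  upper_mx (abc.1.1^-1, abc.1.2^-1, - abc.2 / (abc.1.1 * abc.1.2)) = 1%:M.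
Proof.
case: abc => [[a b] c] /= a0 b0.
rewrite /upper_mx /= !mulmxDl !mulmxDr -!scalemxAl -!scalemxAr.
rewrite !mul_delta_mx_cond /= ?mulr0n ?mulr1n !scaler0 !addr0 !add0r !scalerA.
apply/matrixP => i j; rewrite !mxE.
by case: i j => [[|[|]]] //= hi [[|[|]]] //= hj; field; rewrite ?a0 ?b0.
Qed.

Lemma upper_mx_inj : injective upper_mx.
Proof.
move=> [[a b] c] [[a' b'] c'] /matrixP h.
move: (h 0 0) (h 1 1) (h 0 1); rewrite !mxE /= !mulr0 !mulr1 !addr0 !add0r.
by move=> -> -> ->.
Qed.

(** The columns (u, v) become (a u, c u + b v); where u vanishes, the second is b v, so only b must
    be nonzero. *)
Lemma coversM v W abc : abc.1.2 != 0 ->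
  covers v W -> covers v (W *m upper_mx abc).
Proof.
move=> b0 /eqmxP vW; apply/eqmxP; rewrite mulmxA.
apply: eqmx_trans (eqmxMr _ vW) _.
by rewrite mul_e1_upper; apply: eqmx_scale.
Qed.

(* If [T] misses [W], it misses all [W *m A] with [A] upper triangular and
   invertible, whereas a single point covers all of them. *)
Lemma uncovered_class T W : W \in uncovered T ->
  exists v, (#|uncovered (v |: T)| + q * (q - 1) ^ 2 <= #|uncovered T|)%N.
Proof.
(* As [W] has full column rank, [pinvmx W] is a left inverse and this point is sent to [e1]. *)
case/uncoveredP => Wf WT; exists (e1 *m pinvmx W).
pose D : {set F * F * F} := setX (setX [set~ 0] [set~ 0]) setT.
have DP abc : abc \in D -> abc.1.1 != 0 /\ abc.1.2 != 0.
  by rewrite !inE andbT => /andP[].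
pose cls := [set W *m upper_mx abc | abc in D].
have clsc : #|cls| = (q * (q - 1) ^ 2)%N.
  rewrite card_imset => [|A B /(congr1 (mulmx (pinvmx W)))]; last first.
    by rewrite !mulmxA !mulVpmx // !mul1mx; apply: upper_mx_inj.
  by rewrite !cardsX cardsT !cardsC1 -mulnn -subn1 mulnC.
have clsU : cls \subset uncovered T.
  apply/subsetP => _ /imsetP[A /DP[a0 b0] ->].
  have AV := upper_mxV A a0 b0; apply/uncoveredP; split=> [|v vT].
    rewrite -sub1mx; apply: submx_trans (_ : upper_mx A <= _)%MS; last first.
      by apply/submxP; exists (pinvmx W); rewrite mulmxA mulVpmx ?mul1mx.
    rewrite sub1mx row_full_unit; have := mulmx1_unit AV; by case.
  (* A point covering [W *m A] would cover [W], by the inverse upper triangular matrix. *)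
  apply: contra (WT v vT) => cv; rewrite -[W]mulmx1 -AV mulmxA.
  by apply: coversM => //=; rewrite invr_eq0.
have sub : uncovered (e1 *m pinvmx W |: T) \subset uncovered T :\: cls.
  apply/subsetP => X /uncoveredP[Xf h]; rewrite inE; apply/andP; split.
    apply: contra (h _ (setU11 _ _)) => /imsetP[A /DP[_ b0] ->].
    by apply: coversM => //;
      rewrite /covers -mulmxA mulVpmx // mulmx1 submx_refl.
  by apply/uncoveredP; split=> // v vT; apply: h; rewrite inE vT orbT.
have := subset_leq_card sub; have := subset_leq_card clsU.
rewrite cardsDS // clsc => clsle subc.
by apply: leq_trans (leq_add subc (leqnn _)) _; rewrite subnK.
Qed.

(** Each new point removes a full class, and a nonempty [uncovered T] contains one, so fewer pairs
    than one class means none. *)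
Lemma repair N T :
  (#|uncovered T| < N.+1 * (q * (q - 1) ^ 2))%N ->
  exists T', (#|T'| <= #|T| + N)%N /\ uncovered T' = set0.
Proof.
elim: N T => [|N IH] T hT;
  have [U0|[W /uncovered_class[v hv]]] := set_0Vmem (uncovered T).
- by exists T; rewrite addn0.
- by move: hv hT; rewrite mul1n; lia.
- by exists T; rewrite leq_addr.
have [|T' [T'T T'0]] := IH (v |: T); first by move: hv hT; rewrite !mulSn; lia.
exists T'; split=> //; apply: leq_trans T'T _.
by rewrite cardsU1 addnS -addSn leq_add2r (leq_add (leq_b1 _)).
Qed.

(** * From covering sets to strong blocking sets *)

Lemma PG_normalize T : exists S, [/\ PG_point_set S, (#|S| <= #|T|)%N &
  forall v, v \in T -> v != 0 -> exists2 w, w \in S & (w == v)%MS].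
Proof.
(* The choice depends only on the span of [v]; the default is never reached, since [v] itself
   qualifies. *)
pose nf (v : 'rV[F]_k) := odflt v [pick w | (w == v)%MS].
have nfE v : (nf v == v)%MS.
  by rewrite /nf; case: pickP => [w //|/(_ v)]; rewrite submx_refl.
have nfP v w : (v == w)%MS -> nf v = nf w.
  move=> /eqmxP vw; rewrite /nf.
  have e : (fun u : 'rV_k => (u == v)%MS) =1 (fun u => (u == w)%MS).
    by move=> u; rewrite !vw.
  rewrite (eq_pick e).
  by case: pickP => // /(_ w); rewrite submx_refl.
exists (nf @: (T :\ 0)); split.
- split=> [v /imsetP[w]|v w /imsetP[v' _ ->] /imsetP[w' _ ->]].
    rewrite !inE => /andP[w0 _] ->; apply: contraNneq w0 => w0.
    exact/eqP/(eqmx_row_eq0 _ _ _ _ (nfE w) w0).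
  move=> /eqmxP h; apply: nfP; apply/eqmxP.
  exact: eqmx_trans (eqmx_sym (eqmxP (nfE v'))) (eqmx_trans h (eqmxP (nfE w'))).
- by apply: leq_trans (leq_imset_card _ _) _; rewrite subset_leq_card ?subsetDl.
move=> v vT v0; exists (nf v) => //; apply: imset_f; by rewrite !inE v0.
Qed.

(** If the points in H spanned only K < H, take u with kernel H and v vanishing on K but not on H. A
    point covering (u, v) lies in H, hence in K, where v vanishes: a contradiction. *)
Lemma uncovered0_strong_blocking T S :
  uncovered T = set0 ->
  (forall v, v \in T -> v != 0 -> exists2 w, w \in S & (w == v)%MS) ->
  strong_blocking_set S.
Proof.
move=> T0 TS H Hk; set K := (\sum_(v in S | _) _)%MS.
have KH : (K <= H)%MS by apply/sumsmx_subP => v /andP[_ vH]; rewrite genmxE.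
apply/andP; split=> //; apply: contraT => HK.
(* Needed for [k.-1] to be a true predecessor, so that the cokernel of [H] has rank 1. *)
have k0 : (0 < k)%N.
  have [k0|//] := posnP k; case/negP: HK; apply/row_subP => i.
  by have := ltn_ord i; lia.
have [i Hi] : exists i, ~~ (row i H <= K)%MS.
  apply/existsP; rewrite -negb_forall; apply: contra HK => /forallP h.
  by apply/row_subP.
have [j hj] : exists j, row i H *m col j (cokermx K) != 0.
  apply/existsP; rewrite -negb_forall; apply: contra Hi => /forallP h.
  rewrite submxE; apply/eqP/rowP => j; rewrite -mul_col_entry.
  by have /eqP -> := h j; rewrite !mxE.
have [c hc] : exists c, col c (cokermx H) != 0.
  apply/existsP; rewrite -negb_forall; apply/negP => /forallP h.
  have : \rank (cokermx H) = 0%N.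
    apply/eqP; rewrite mxrank_eq0; apply/eqP/matrixP => a b.
    by have /eqP/colP/(_ a) := h b; rewrite !mxE.
  by rewrite mxrank_coker Hk; lia.
set u := col c _ in hc; set v := col j _ in hj.
have Hu : H *m u = 0 by rewrite /u colE mulmxA mulmx_coker mul0mx.
have Kv : K *m v = 0 by rewrite /v colE mulmxA mulmx_coker mul0mx.
have kerH : (kermx u <= H)%MS.
  have : (H <= kermx u)%MS by rewrite sub_kermx Hu.
  move/mxrank_leqif_sup => [_ <-].
  rewrite mxrank_ker Hk; have -> : \rank u = 1%N; last by rewrite subn1.
  by apply/eqP; rewrite eqn_leq rank_leq_col lt0n mxrank_eq0.
pose W : 'M_(k, 2) := \matrix_(a, l) (if l == 0 then u else v) a 0.
have W0 (x : 'rV_k) : (x *m W) 0 0 = (x *m u) 0 0.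
  rewrite -mul_col_entry; congr ((_ *m _) 0 0).
  by apply/colP => a; rewrite !mxE.
have W1 (x : 'rV_k) : (x *m W) 0 1 = (x *m v) 0 0.
  rewrite -mul_col_entry; congr ((_ *m _) 0 0).
  by apply/colP => a; rewrite !mxE.
have nz (x : 'M[F]_1) : x != 0 -> x 0 0 != 0.
  by apply: contra_neq => x0; rewrite [x]mx11_scalar x0 raddf0.
have hu : row i H *m u = 0 by rewrite -row_mul Hu row0.
(* [W] has full column rank: row [i] of [H] yields [e1], and any [y] outside the kernel of [u] then
   yields the other unit vector. *)
have e1W : (e1 <= W)%MS.
  have s0 := nz _ hj; rewrite -(eqmx_scale _ s0).
  apply: submx_trans (submxMl (row i H) W).
  by rewrite [row i H *m W]row2_sum_delta W0 W1 hu
    [X in X *: delta_mx 0 0]mxE scale0r add0r.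
have e0W : ((delta_mx 0 0 : 'rV[F]_2) <= W)%MS.
  have [y yu] : exists y : 'rV_k, y *m u != 0.
    have /cV0Pn[a ua] := hc; exists (delta_mx 0 a); rewrite -rowE.
    by apply: contra_neq ua => /rowP/(_ 0); rewrite !mxE.
  rewrite -(eqmx_scale _ (nz _ yu)) -W0.
  have -> : (y *m W) 0 0 *: delta_mx 0 0 = y *m W - (y *m W) 0 1 *: e1.
    by rewrite {2}[y *m W]row2_sum_delta addrK.
  by rewrite addmx_sub ?submxMl // eqmx_opp scalemx_sub.
have Wf : row_full W.
  rewrite -sub1mx; apply/row_subP => l; rewrite row1.
  by case: l => [[|[|]]].
have : W \notin uncovered T by rewrite T0 inE.
rewrite inE Wf /= negb_forall => /existsP[x].
rewrite negb_imply negbK => /andP[xT].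
rewrite /covers => /andP[/sub_rVP[a aE] /sub_rVP[b bE]].
have xu : x *m u = 0.
  by rewrite [LHS]mx11_scalar -W0 aE !mxE mulr0 raddf0.
have xvb : 1 = b * (x *m v) 0 0.
  by rewrite -W1; move/rowP/(_ 1): bE; rewrite !mxE.
have x0 : x != 0.
  apply: contra_eq_neq xvb => ->; rewrite mul0mx mxE mulr0.
  exact: oner_neq0.
have [w wS /eqmxP wx] := TS x xT x0.
have xH : (x <= H)%MS by apply: submx_trans kerH; rewrite sub_kermx xu.
have xK : (x <= K)%MS.
  rewrite -wx -(genmxE w); apply: (sumsmx_sup w) => //.
  by rewrite wS wx.
have xv0 : x *m v = 0.
  by case/submxP: xK => D ->; rewrite -mulmxA Kv mulmx0.
by move/eqP: xvb; rewrite xv0 mxE mulr0 oner_eq0.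
Qed.
End Covering.

(** * Numerical estimates for the numbers of lines and extra points *)

Lemma ln_bound_nat (R : realType) (q b k m n : nat) :
  (0 < q)%N -> (0 < b)%N ->
  m%:R * (2 * k%:R * ln q%:R) < n%:R * ln (q%:R ^+ 4 / b%:R) :> R ->
  (q ^ (2 * k * m) * b ^ n < q ^ (4 * n))%N.
Proof.
move=> q0 b0; have qR : 0 < q%:R :> R by rewrite ltr0n.
have bR : 0 < b%:R :> R by rewrite ltr0n.
rewrite ln_div ?posrE ?exprn_gt0 // lnXn // => h.
rewrite -(ltr_nat R) natrM !natrX.
rewrite -ltr_ln ?posrE ?mulr_gt0 ?exprn_gt0 // lnM ?posrE ?exprn_gt0 // !lnXn //.
move: h; rewrite -![ln _ *+ _]mulr_natl !natrM; lra.
Qed.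

Lemma lines_and_points_count (R : realType) (q k : nat) :
  (1 < q)%N ->
  let x : R := 2 * k%:R / (ln (q%:R ^+ 4 / (q%:R ^+ 3 - q%:R + 1)) / ln q%:R) in
  exists t N, (q%:R + 1) * t%:R + N%:R <= (q%:R + 1) * x :> R /\
   forall u : nat, (u * q ^ (4 * t) <= q ^ (2 * k) * (q ^ 3 - q + 1) ^ t)%N ->
     (u < N.+1 * (q * (q - 1) ^ 2))%N.
Proof.
move=> q1 x; have q0 : (0 < q)%N by lia.
set b := (q ^ 3 - q + 1)%N; have b0 : (0 < b)%N by rewrite /b; lia.
have qq : (q <= q ^ 3)%N by rewrite -{1}(expn1 q) leq_pexp2l.
have bE : q%:R ^+ 3 - q%:R + 1 = b%:R :> R.
  by rewrite /b natrD natrB // natrX.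
have b4 : (b < q ^ 4)%N by rewrite /b; nia.
have L0 : 0 < ln (q%:R ^+ 4 / b%:R) :> R.
  by rewrite ln_gt0 // ltr_pdivlMr ?ltr0n // mul1r -natrX ltr_nat.
have Q0 : 0 < ln q%:R :> R by rewrite ln_gt0 // ltr1n.
have xL : x * ln (q%:R ^+ 4 / b%:R) = 2 * k%:R * ln q%:R.
  by rewrite /x bE; field; rewrite !gt_eqF.
have x0 : 0 <= x by rewrite -(pmulr_lge0 _ L0) xL mulr_ge0 ?mulr_ge0 ?ler0n // ltW.
pose t := Num.trunc x.
have /andP[tx xt] : t%:R <= x < t.+1%:R by apply: truncn_itv.
have key m n : m%:R * x < n%:R -> (q ^ (2 * k * m) * b ^ n < q ^ (4 * n))%N.
  move=> h; apply: (@ln_bound_nat R) => //.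
  by rewrite -xL mulrA ltr_pM2r.
have q3 : 0 <= q%:R + 1 :> R by rewrite addr_ge0 ?ler0n.
have kt : (q ^ (2 * k) * b ^ t.+1 < q ^ (4 * t.+1))%N.
  by have := key 1%N t.+1; rewrite muln1 mul1r; apply.
have C0 n : (0 < q ^ n)%N by rewrite expn_gt0 q0.
(* Since t + 1 > x, the greedy bound leaves u < q^4 / b pairs. *)
have step u : (u * q ^ (4 * t) <= q ^ (2 * k) * b ^ t)%N -> (u * b < q ^ 4)%N.
  move=> h; rewrite -(ltn_pmul2r (C0 (4 * t)%N)) -expnD -mulnS.
  apply: leq_ltn_trans kt; rewrite expnS mulnAC mulnC [leqRHS]mulnCA.
  by rewrite leq_mul2l h orbT.
have [q2|q2] := ltnP 2 q.
  exists t, 0%N; split; first by rewrite addr0 ler_wpM2l.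
  move=> u /step ub; rewrite mul1n ltnNge; apply/negP => hu.
  (* This is absurd for q > 2, because (q - 1)^2 >= 4 and 4 b >= q^3. *)
  have : (q * (q - 1) ^ 2 * b < q ^ 4)%N.
    by apply: leq_ltn_trans ub; rewrite leq_mul2r hu orbT.
  rewrite ltnNge => /negP; apply; rewrite expnS -mulnA leq_mul2l.
  apply/orP; right; apply: (@leq_trans (2 ^ 2 * b)).
    have : (q * 3 ^ 2 <= q ^ 3)%N.
      by rewrite (expnS q) leq_mul2l leq_exp2r // q2 orbT.
    by rewrite /b; lia.
  by rewrite leq_mul2r leq_exp2r //; lia.
have q2E : q = 2%N by lia.
have b7 : b = 7%N by rewrite /b q2E.
(* For q = 2 a class has 2 pairs and 7 u < 16 gives u <= 2, so one point suffices; it costs 1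
   against q + 1 = 3 per line. *)
have [h|h] := lerP (3 * t%:R + 1) (3 * x).
  exists t, 1%N; split; first by rewrite q2E; lra.
  by move=> u /step; rewrite b7 q2E; lia.
exists t, 0%N; split; first by rewrite addr0 ler_wpM2l.
(* Now 3 x < 3 t + 1; comparing with the cube of the greedy bound gives 7 u^3 < 16, so u <= 1. *)
have k3 : (q ^ (2 * k * 3) * b ^ (3 * t).+1 < q ^ (4 * (3 * t).+1))%N.
  by apply: key; rewrite -[(3 * t).+1%:R]natr1 natrM.
move=> u hu.
have : ((u * q ^ (4 * t)) ^ 3 <= (q ^ (2 * k) * b ^ t) ^ 3)%N.
  by rewrite leq_exp2r.
rewrite !expnMn -!expnM => hu3.
have : (u ^ 3 * 7 < 16)%N.
  rewrite -(ltn_pmul2r (C0 (4 * t * 3)%N)).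
  have -> : (16 * q ^ (4 * t * 3) = q ^ (4 * (3 * t).+1))%N.
    by rewrite (_ : 4 * (3 * t).+1 = 4 + 4 * t * 3)%N ?expnD ?q2E //; lia.
  apply: leq_ltn_trans k3; rewrite -b7 (expnS b) [leqRHS]mulnCA.
  by rewrite [leqLHS]mulnAC [leqLHS]mulnC leq_mul2l [(3 * t)%N]mulnC hu3 orbT.
move=> u7; rewrite q2E ltnNge; apply/negP => u2.
have u8 : (2 ^ 3 <= u ^ 3)%N by rewrite leq_exp2r.
by have := leq_ltn_trans (leq_mul u8 (leqnn 7)) u7.
Qed.

Theorem theorem1p3 (R : realType) (F : finFieldType) (k : nat) :
  (2 <= k)%N ->
  let q : R := #|F|%:R in
  exists S : {set 'rV[F]_k},
    PG_point_set S /\ strong_blocking_set S /\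
    (#|S|%:R : R) <= (q + 1) * (2 * k%:R) / (ln (q ^+ 4 / (q ^+ 3 - q + 1)) / ln q).
Proof.
move=> _ q; have q1 : (1 < #|F|)%N := card_finNzRing_gt1 F.
have [t [N [tN small]]] := lines_and_points_count R _ k q1.
have [T1 [T1t /small/repair[T2 [T21 T20]]]] := greedy_lines F k t.
have [S [PS ST TS]] := PG_normalize _ _ T2.
exists S; split=> //; split; first exact: uncovered0_strong_blocking T20 TS.
rewrite -mulrA; apply: le_trans tN.
have : (#|S| <= (#|F| + 1) * t + N)%N.
  by apply: leq_trans ST (leq_trans T21 _); rewrite leq_add2r.
by rewrite -(ler_nat R) natrD natrM natrD.
Qed.
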